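(* Let $\mathcal{C}$ be a finite abstract simplicial complex and $\mathcal{M}$ a matroid on the same finite ground set $V$, and let $d\ge 0$ be an integer. If $\mathcal{C}$ is $d$-Leray and $r(\mathcal{M}[V\setminus A])\ge d+2$ for all $A\in\mathcal{C}$, then $\mathbf{RG}(\mathcal{C}^\star,\mathcal{M}^* )$ is connected.
   Context: $\mathcal{C}[X]=\{\sigma\in\mathcal{C}:\sigma\subseteq X\}$, $\mathcal{M}[X]=\{A\in\mathcal{M}:A\subseteq X\}$, $r$ is matroid rank. $\mathcal{C}$ is $d$-Leray if $\widetilde H_i(\mathcal{C}[X];\mathbb{Q})=0$ for all $X\subseteq V$ and all $i\ge d$. The Alexander dual is $\mathcal{C}^\star=\{X\subseteq V: V\setminus X\notin\mathcal{C}\}$. The dual matroid is $\mathcal{M}^*=\{A\subseteq V: r(\mathcal{M}[V\setminus A])=r(\mathcal{M})\}$. For a complex $\mathcal{D}$ and matroid $\mathcal{N}$ on $V$, $\mathbf{RG}(\mathcal{D},\mathcal{N})$ is the graph whose vertices are the bases of $\mathcal{N}$ that are simplices of $\mathcal{D}$, two being adjacent if their union is a simplex of $\mathcal{D}$ of cardinality $r(\mathcal{N})+1$. *)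

(* Defs.v *)
From mathcomp Require Import all_boot all_order all_algebra.
Set Implicit Arguments. Unset Strict Implicit. Unset Printing Implicit Defensive.
Import GRing.Theory Num.Theory.
Local Open Scope ring_scope.

Section Defs.
Variable V : finType.

Definition is_complex (C : {set {set V}}) : Prop :=
  forall s t : {set V}, s \in C -> t \subset s -> t \in C.

Definition induced (C : {set {set V}}) (X : {set V}) : {set {set V}} :=
  [set s in C | s \subset X].

Definition alexander_dual (C : {set {set V}}) : {set {set V}} :=
  [set X : {set V} | (~: X) \notin C].

(* Incidence coefficient [s : t] of the simplicial boundary, the vertices of V
   being ordered by enum_rank: if t = s minus a vertex v, the coefficient is
   (-1)^(number of vertices of s smaller than v); otherwise 0. *)
Definition incidence (s t : {set V}) : rat :=
  if (t \subset s) && (#|s| == #|t|.+1) then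
    (-1) ^+ #|[set u in t | [exists v in s :\: t, (enum_rank u < enum_rank v)%N]]|
  else 0.

Definition is_chain (K : {set {set V}}) (i : nat) (c : {ffun {set V} -> rat}) :=
  forall s, c s != 0 -> s \in K /\ #|s| = i.+1.

(* Boundary operator (augmented: 0-faces are sent to the empty face, so the
   homology obtained is reduced homology). *)
Definition boundary (c : {ffun {set V} -> rat}) (t : {set V}) : rat :=
  \sum_(s : {set V}) c s * incidence s t.

Definition reduced_homology_vanishes (K : {set {set V}}) (i : nat) : Prop :=
  forall c, is_chain K i c -> (forall t, boundary c t = 0) ->
  exists b, is_chain K i.+1 b /\ (forall t, boundary b t = c t).

Definition leray (C : {set {set V}}) (d : nat) : Prop :=
  forall (X : {set V}) (i : nat), (d <= i)%N ->
    reduced_homology_vanishes (induced C X) i.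

Definition is_matroid (M : {set {set V}}) : Prop :=
  [/\ set0 \in M,
      (forall A B : {set V}, A \in M -> B \subset A -> B \in M) &
      (forall A B : {set V}, A \in M -> B \in M -> (#|A| < #|B|)%N ->
         exists2 x, x \in B :\: A & x |: A \in M)].

Definition mrank (M : {set {set V}}) (A : {set V}) : nat :=
  \max_(I in M | I \subset A) #|I|.

Definition mrankT (M : {set {set V}}) : nat := mrank M setT.

Definition dual_matroid (M : {set {set V}}) : {set {set V}} :=
  [set A : {set V} | mrank M (~: A) == mrankT M].

Definition is_basis (M : {set {set V}}) (B : {set V}) : bool :=
  (B \in M) && (#|B| == mrankT M).

Definition RG_vertex (D N : {set {set V}}) (B : {set V}) : bool :=
  is_basis N B && (B \in D).

Definition RG_adj (D N : {set {set V}}) : rel {set V} :=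
  fun B1 B2 => [&& RG_vertex D N B1, RG_vertex D N B2,
                   (B1 :|: B2) \in D & #|B1 :|: B2| == (mrankT N).+1].

Definition RG_connected (D N : {set {set V}}) : Prop :=
  forall B1 B2, RG_vertex D N B1 -> RG_vertex D N B2 ->
    connect (RG_adj D N) B1 B2.

End Defs.

(* Main.v *)
(* Bases of the dual matroid are complements of bases of M, so the graph lives
   on the bases B of M outside C, adjacent bases being exchanges whose
   intersection is outside C. If it were disconnected, the independent sets
   outside C would split into two incomparable families Q1 and Q2.  Fix bases B1
   in Q1 and B2 in Q2. On the cubes [A, B] of the face poset of C there are chain
   maps f1, f2 with f_i [A, B] carried by the simplex B_i minus A; as M[V minus A]
   is acyclic up to dimension d, they are homotopic there up to dimension d, by a
   homotopy x. Subtracting from f1 only the Q1-part of x gives a chain map whose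
   values lie in C[V minus A] up to dimension d, and the Leray property extends it
   to all dimensions. Such a map moves every face off itself, which a Lefschetz
   trace argument forbids. *)
Require Import Defs.
From mathcomp Require Import all_boot all_order all_algebra.
From mathcomp Require Import ring lra.
Set Implicit Arguments. Unset Strict Implicit. Unset Printing Implicit Defensive.
Import GRing.Theory Num.Theory.
Local Open Scope ring_scope.

(** * Simplicial chains with rational coefficients and their boundary *)

Section Chains.
Variable V : finType.
Implicit Types (s t A B S X : {set V}) (K M C : {set {set V}}) (u v : V) (c : {ffun {set V} -> rat}).

Definition sgn S v : rat := incidence S (S :\ v).

Lemma sgnE S v : v \in S ->
  sgn S v = (-1) ^+ #|[set u in S | (enum_rank u < enum_rank v)%N]|.
Proof.
move=> vS; rewrite /sgn /incidence subsetDl (cardsD1 v S) vS eqxx /=.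
congr (_ ^+ _); apply: eq_card => u; rewrite !inE.
have -> : S :\: (S :\ v) = [set v].
  by rewrite setDDr setDv set0U; apply/setIidPr; rewrite sub1set.
have -> : [exists w in [set v], (enum_rank u < enum_rank w)%N]
          = (enum_rank u < enum_rank v)%N.
  apply/existsP/idP => [[w]|uv]; first by rewrite inE => /andP[/eqP->].
  by exists v; rewrite inE eqxx.
by case: (eqVneq u v) => [->|]; rewrite ?ltnn ?andbF.
Qed.

Lemma sgn_sqr S v : v \in S -> sgn S v * sgn S v = 1.
Proof. by move=> vS; rewrite sgnE // -expr2 sqrr_sign. Qed.

(** Both products delete [u] and [v], in opposite orders. Deleting the smaller vertex first lowers
    by one the count that gives the sign of the larger; deleting the larger first leaves the count
    of the smaller unchanged. *)
Lemma sgn_anti S u v : u \in S -> v \in S -> u != v ->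
  sgn S u * sgn (S :\ u) v = - (sgn S v * sgn (S :\ v) u).
Proof.
wlog uv : u v / (enum_rank u < enum_rank v)%N => [hw uS vS nuv|].
  have : enum_rank u != enum_rank v by apply: contra nuv => /eqP/enum_rank_inj ->.
  rewrite neq_ltn => /orP[|] h; first exact: hw.
  by rewrite [in RHS]hw ?opprK // eq_sym.
move=> uS vS nuv.
rewrite (@sgnE (S :\ u) v) ?inE 1?eq_sym ?nuv ?vS //.
rewrite (@sgnE (S :\ v) u) ?inE ?nuv ?uS //.
rewrite (sgnE uS) (sgnE vS).
have -> : #|[set w in S | (enum_rank w < enum_rank v)%N]| =
  #|[set w in S :\ u | (enum_rank w < enum_rank v)%N]|.+1.
  rewrite (cardsD1 u) inE uS uv add1n; congr _.+1.
  by apply: eq_card => w; rewrite !inE andbA.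
have -> : #|[set w in S :\ v | (enum_rank w < enum_rank u)%N]| =
  #|[set w in S | (enum_rank w < enum_rank u)%N]|.
  apply: eq_card => w; rewrite !inE.
  by case: (eqVneq w v) => [->|] //=; rewrite vS /= ltnNge ltnW.
by rewrite exprS; ring.
Qed.

Definition bd c : {ffun {set V} -> rat} := [ffun t => boundary c t].

Lemma bdE c t : bd c t = \sum_(v | v \notin t) c (v |: t) * sgn (v |: t) v.
Proof.
rewrite ffunE /boundary.
pose T := [set v |: t | v in ~: t].
rewrite (bigID (mem T)) /= [X in _ + X]big1 ?addr0 => [|s sT]; last first.
  rewrite /incidence; case: ifP; rewrite ?mulr0 // => /andP[ts /eqP cs].
  have [v /setDP [vs vt]] : exists v, v \in s :\: t.
    by apply/set0Pn; rewrite -card_gt0 cardsDS // cs subSnn.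
  case/imsetP: sT; exists v; rewrite ?inE //; apply/eqP.
  by rewrite eq_sym eqEcard subUset sub1set vs ts cardsU1 vt cs /=.
rewrite big_imset /= => [|u v]; last first.
  rewrite !inE => ut vt /setP/(_ u); rewrite !inE eqxx /= (negPf ut) orbF.
  by move/esym/eqP.
apply: eq_big => [v|v]; rewrite !inE // => vt; congr (_ * _).
by rewrite /sgn setU1K.
Qed.

Lemma sum_anti (G : V -> V -> rat) :
  (forall u v, G u v = - G v u) -> \sum_u \sum_v G u v = 0.
Proof.
move=> aG; set x := LHS; have : x = - x.
  rewrite {1}/x exchange_big /= /x -sumrN; apply: eq_bigr => u _.
  by rewrite -sumrN; apply: eq_bigr => v _.
lra.
Qed.

Lemma setU1CA u v t : u |: (v |: t) = v |: (u |: t).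
Proof. by rewrite setUCA. Qed.

Lemma sgn_antiU u v t : u \notin t -> v \notin t -> u != v ->
  sgn (v |: (u |: t)) v * sgn (u |: t) u =
  - (sgn (u |: (v |: t)) u * sgn (v |: t) v).
Proof.
move=> ut vt uv; rewrite (setU1CA u v); set S := v |: _.
have -> : u |: t = S :\ v by rewrite setU1K // !inE negb_or eq_sym uv.
have -> : v |: t = S :\ u by rewrite /S setU1CA setU1K // !inE negb_or uv.
by rewrite sgn_anti // ?inE ?eqxx ?orbT // eq_sym.
Qed.

Lemma bdK c : bd (bd c) = 0.
Proof.
apply/ffunP => t; rewrite bdE [RHS]ffunE.
pose G u v := if [&& u \notin t, v \notin t & u != v] then
  c (v |: (u |: t)) * (sgn (v |: (u |: t)) v * sgn (u |: t) u) else 0.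
rewrite -[RHS](@sum_anti G) => [|u v]; last first.
  rewrite /G eq_sym andbCA; case: ifP; rewrite ?oppr0 // => /and3P[ut vt uv].
  by rewrite sgn_antiU 1?eq_sym // setU1CA mulrN.
rewrite big_mkcond; apply: eq_bigr => u _; rewrite /G.
case: ifP => ut; last by rewrite big1.
rewrite bdE mulr_suml big_mkcond; apply: eq_bigr => v _ /=.
by rewrite !inE negb_or eq_sym andbC; case: ifP; rewrite ?mulrA.
Qed.

Lemma bd_lin (a : rat) c c' t :
  bd [ffun s => a * c s + c' s] t = a * bd c t + bd c' t.
Proof.
rewrite !bdE mulr_sumr -big_split; apply: eq_bigr => v _ /=; rewrite ffunE; ring.
Qed.

Lemma addcE c c' t : (c + c') t = c t + c' t. Proof. by rewrite ffunE. Qed.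

Lemma oppcE c t : (- c) t = - c t. Proof. by rewrite ffunE. Qed.

Lemma bd0 : bd 0 = 0.
Proof. by apply/ffunP => t; rewrite bdE ffunE big1 // => v _; rewrite ffunE mul0r. Qed.

Lemma bdD c c' : bd (c + c') = bd c + bd c'.
Proof.
apply/ffunP => t; rewrite addcE !bdE -big_split.
by apply: eq_bigr => v _ /=; rewrite ffunE mulrDl.
Qed.

Lemma bdN c : bd (- c) = - bd c.
Proof.
apply/ffunP => t; rewrite oppcE !bdE -sumrN.
by apply: eq_bigr => v _ /=; rewrite ffunE mulNr.
Qed.

Lemma bdB c c' : bd (c - c') = bd c - bd c'.
Proof. by rewrite bdD bdN. Qed.

(* Degrees are cardinalities of faces, so that the empty face has degree 0. *)
Definition on_faces (K : {set {set V}}) (j : nat) c :=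
  forall s, c s != 0 -> s \in K /\ #|s| = j.

Definition acyclic (K : {set {set V}}) (j : nat) :=
  forall c, on_faces K j c -> bd c = 0 -> exists2 b, on_faces K j.+1 b & bd b = c.

Lemma on_faces0 K j : on_faces K j 0.
Proof. by move=> s; rewrite ffunE eqxx. Qed.

Lemma on_facesD K j c c' :
  on_faces K j c -> on_faces K j c' -> on_faces K j (c + c').
Proof.
move=> hc hc' s; rewrite ffunE; case: (eqVneq (c s) 0) => [->|/hc //].
by rewrite add0r => /hc'.
Qed.

Lemma on_facesN K j c : on_faces K j c -> on_faces K j (- c).
Proof. by move=> hc s; rewrite ffunE oppr_eq0 => /hc. Qed.

Lemma on_faces_bd K j c : is_complex K -> on_faces K j.+1 c -> on_faces K j (bd c).
Proof.
move=> Kc hc t; case: (boolP [exists v, (v \notin t) && (c (v |: t) != 0)]).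
  case/existsP => v /andP[vt /hc[sK]]; rewrite cardsU1 vt => -[<-] _.
  by split=> //; apply: Kc sK (subsetUr _ _).
rewrite negb_exists => /forallP h; rewrite bdE big1 ?eqxx // => v vt.
by have := h v; rewrite vt /= negbK => /eqP->; rewrite mul0r.
Qed.

(** * Cones, and the splitting of a chain at a vertex *)

Definition cone v c : {ffun {set V} -> rat} :=
  [ffun s : {set V} => if v \in s then c (s :\ v) * sgn s v else 0].
Definition avoiding v c : {ffun {set V} -> rat} :=
  [ffun t : {set V} => if v \in t then 0 else c t].
(** The sign is the one that [cone v] undoes, as [sgn] squares to 1. *)
Definition link_part v c : {ffun {set V} -> rat} :=
  [ffun t : {set V} => if v \in t then 0 else c (v |: t) * sgn (v |: t) v].

Lemma cone_split v c : c = avoiding v c + cone v (link_part v c).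
Proof.
apply/ffunP => s; rewrite !ffunE; case: ifP => vs; last by rewrite addr0.
by rewrite !inE eqxx /= setD1K // -mulrA sgn_sqr // mulr1 add0r.
Qed.

Lemma sgn_swap S u v : u \in S -> v \in S -> u != v ->
  sgn S v * sgn S u = - (sgn (S :\ v) u * sgn (S :\ u) v).
Proof.
move=> uS vS uv; have h3 := sgn_anti uS vS uv; have h2 := sgn_sqr uS.
have h1 : sgn (S :\ v) u * sgn (S :\ v) u = 1 by rewrite sgn_sqr // !inE uv.
rewrite -[LHS]mulr1 -h1.
transitivity ((sgn S v * sgn (S :\ v) u) * sgn S u * sgn (S :\ v) u); first by ring.
rewrite -[X in X * _ * _]opprK -h3.
transitivity (- (sgn S u * sgn S u) * (sgn (S :\ v) u * sgn (S :\ u) v)); first by ring.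
by rewrite h2 mulN1r.
Qed.

(** The sign in [cone] lets the apex act as the first vertex of each face, wherever it stands in the
    order; [sgn_swap] gives the minus sign of the second term. *)
Lemma bd_cone v c : (forall s : {set V}, c s != 0 -> v \notin s) ->
  bd (cone v c) = c - cone v (bd c).
Proof.
move=> hc; apply/ffunP => t; rewrite bdE addcE oppcE [cone _ _ t]ffunE.
case: ifP => vt.
  have -> : c t = 0 by apply/eqP; apply: contraTT vt => /hc.
  rewrite add0r bdE mulr_suml -sumrN.
  rewrite [RHS](bigD1 v) /= ?inE ?eqxx // setD1K //.
  have -> : c t = 0 by apply/eqP; apply: contraTT vt => /hc.
  rewrite !mul0r oppr0 add0r; apply: eq_big => [u|u ut].
    by rewrite !inE negb_and negbK; case: eqVneq => [->|]; rewrite ?vt ?andbT.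
  have uv : u != v by apply: contraNneq ut => ->.
  rewrite ffunE !inE vt orbT -mulrA sgn_swap ?inE ?eqxx ?vt ?orbT // setU1K //.
  have -> : (u |: t) :\ v = u |: t :\ v.
    by rewrite setDUl; congr (_ :|: _); apply/setDidPl; rewrite disjoints1 inE.
  ring.
rewrite subr0 (bigD1 v) ?vt //= big1 ?addr0 => [|u /andP[ut uv]]; last first.
  by rewrite ffunE !inE eq_sym (negPf uv) vt mul0r.
by rewrite ffunE !inE eqxx /= setU1K ?vt // -mulrA sgn_sqr ?inE ?eqxx // mulr1.
Qed.

Lemma avoiding_notin v c (s : {set V}) : avoiding v c s != 0 -> v \notin s.
Proof. by rewrite ffunE; case: ifP; rewrite ?eqxx. Qed.

Lemma link_part_notin v c (s : {set V}) : link_part v c s != 0 -> v \notin s.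
Proof. by rewrite ffunE; case: ifP; rewrite ?eqxx. Qed.

(** On faces without [v] the cone term of [bd_cone] drops out of the equation [bd c = 0]; on faces
    with [v] both sides are zero. *)
Lemma bd_avoiding v c : bd c = 0 -> bd (avoiding v c) = - link_part v c.
Proof.
move=> c0; have := c0; rewrite {1}(cone_split v c) bdD bd_cone; last exact: link_part_notin.
move=> h; apply/ffunP => t; have /ffunP/(_ t) := h.
rewrite !addcE !oppcE [cone _ _ _]ffunE; case: ifP => vt; last first.
  by rewrite subr0 [RHS]ffunE => /eqP; rewrite addr_eq0 => /eqP.
move=> _; rewrite [link_part v c t]ffunE vt oppr0 bdE big1 // => u _.
by rewrite ffunE !inE vt orbT mul0r.
Qed.

Lemma bd_link_part v c : bd c = 0 -> bd (link_part v c) = 0.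
Proof. by move=> /(bd_avoiding v) h; rewrite -[link_part v c]opprK -h bdN bdK oppr0. Qed.

(** The filling is the cone over the part of [c] off [v]. The faces of [c] through [v] come back
    because the boundary of that part is minus the link. *)
Lemma acyclic_cone K v j : (forall s, s \in K -> v |: s \in K) -> acyclic K j.
Proof.
move=> Kv c hc c0; exists (cone v (avoiding v c)).
  move=> s; rewrite !ffunE; case: ifP; rewrite ?eqxx // => vs.
  rewrite !inE eqxx /=; case: (eqVneq (c (s :\ v)) 0) => [->|/hc[sK <-] _].
    by rewrite mul0r eqxx.
  by rewrite (cardsD1 v s) vs -{1}(setD1K vs) Kv.
rewrite bd_cone; last exact: avoiding_notin.
rewrite bd_avoiding // [RHS](cone_split v); congr (_ + _).
by apply/ffunP => s; rewrite !ffunE; case: ifP; rewrite ?oppr0 // mulNr opprK.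
Qed.

Lemma induced_complex K X : is_complex K -> is_complex (induced K X).
Proof.
move=> Kc s t; rewrite !inE => /andP[sK sX] ts.
by rewrite (Kc _ _ sK ts) (subset_trans ts).
Qed.

(** * Matroid complexes are acyclic below their rank *)

Lemma matroid_augment M A I : is_matroid M -> A \in M -> I \in M -> (#|A| <= #|I|)%N ->
  exists2 J, J \in M & [/\ A \subset J, J \subset A :|: I & #|J| = #|I|].
Proof.
case=> M0 Ms Mx; elim: {A}(#|I| - #|A|)%N {-2}A (erefl (#|I| - #|A|)%N) => [|n IHn] A En AM IM AI.
  by exists A => //; split=> //; [exact: subsetUl | apply/eqP; rewrite eqn_leq AI -subn_eq0 En].
have ltAI : (#|A| < #|I|)%N by rewrite -subn_gt0 En.
have [x /setDP[xI xA] xM] := Mx _ _ AM IM ltAI.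
have cx : #|x |: A| = #|A|.+1 by rewrite cardsU1 xA.
have [||||J JM [AJ JA cJ]] := IHn (x |: A); rewrite ?cx //; first by rewrite subnS En.
exists J => //; split=> //; first by apply: subset_trans AJ; apply: subsetUr.
apply: subset_trans JA _; rewrite subUset subsetUr andbT subUset sub1set inE xI orbT.
exact: subsetUl.
Qed.

(** The contraction of [v], as its link. It is empty when [v] is a loop, hence the hypothesis on
    [[set v]] below. *)
Definition contract (M : {set {set V}}) v : {set {set V}} :=
  [set s in M | (v \notin s) && (v |: s \in M)].

Lemma contract_matroid M v : is_matroid M -> [set v] \in M ->
  is_matroid (contract M v).
Proof.
case=> M0 Ms Mx vM; split.
- by rewrite !inE M0 setU0 vM.
- move=> A B; rewrite !inE => /and3P[AM vA vAM] BA; apply/and3P; split.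
  + exact: Ms AM BA.
  + by apply: contra vA; apply: (subsetP BA).
  + by apply: Ms vAM _; apply: setUS.
- move=> A B; rewrite !inE => /and3P[AM vA vAM] /and3P[BM vB vBM] AB.
  have [|x] := Mx _ _ vAM vBM; first by rewrite !cardsU1 vA vB.
  rewrite !inE negb_or => /andP[/andP[xv xA]]; rewrite (negPf xv) /= => xB xM.
  exists x; rewrite ?inE ?xA // setU1CA xM negb_or eq_sym xv vA !andbT.
  by apply: Ms xM _; apply: setUS; apply: subsetUr.
Qed.

(** Deletion and contraction, by induction on [X]. If [X] lies in [I], the complex is a full
    simplex. Otherwise some [v] in [X] is outside [I], and deleting it keeps [I]. The link of [v] in
    the cycle bounds some [a] in the contraction, the rest plus [a] bounds some [b] in the deletion,
    and [b - cone v a] fills the cycle. *)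
Lemma matroid_acyclic M X (I : {set V}) j : is_matroid M ->
  I \in M -> I \subset X -> (j < #|I|)%N -> acyclic (induced M X) j.
Proof.
elim: {X}_.+1 {-2}X (ltnSn #|X|) M I j => // n IHn X Xn M I j MM IM IX jI.
have [M0 Ms Mx] := MM.
have [XI|] := boolP (X \subset I).
  have [v vI] : exists v, v \in I by apply/set0Pn; rewrite -card_gt0; case: (#|I|) jI.
  apply: (@acyclic_cone _ v) => s; rewrite !inE => /andP[sM sX].
  have vX : v |: s \subset X by rewrite subUset sub1set sX (subsetP IX).
  by rewrite vX (Ms _ _ IM (subset_trans vX XI)).
case/subsetPn => v vX vI c hc c0.
have X'n : (#|X :\ v| < n)%N by move: Xn; rewrite (cardsD1 v X) vX ltnS.
have IX' : I \subset X :\ v by rewrite subsetD1 IX.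
have hl s : link_part v c s != 0 -> [/\ v \notin s, v |: s \in M, v |: s \subset X & #|s|.+1 = j].
  move=> ls; have vs := link_part_notin ls; move: ls; rewrite ffunE (negPf vs).
  case: (eqVneq (c (v |: s)) 0) => [->|/hc[]]; first by rewrite mul0r eqxx.
  by rewrite inE cardsU1 vs => /andP[].
have [a ha bda] : exists2 a, on_faces (induced (contract M v) (X :\ v)) j a &
    bd a = link_part v c.
  (* If [v] is a loop, no independent set contains it and the link part is zero. *)
  have [vM|vM] := boolP ([set v] \in M); last first.
    exists 0; first exact: on_faces0.
    rewrite bd0; apply/ffunP => s; rewrite ffunE; apply/esym/eqP; apply/negPn/negP.
    case/hl => _ vsM _ _; case/negP: vM; apply: Ms vsM _; apply: subsetUl.
  (* A cycle of degree 0 has no face through [v], so its link part is zero too. *)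
  case: j jI hc hl => [|j] jI hc hl.
    exists 0; first exact: on_faces0.
    by rewrite bd0; apply/ffunP => s; rewrite ffunE; apply/esym/eqP; apply/negPn/negP => /hl[].
  (* The rank needed in the contraction: enlarge [[set v]] from [I] to the size of [I], at least
     [j + 2], remove [v] and keep [j + 1] elements. *)
  have [I' I'M [vI' I'X I'j]] : exists2 I', v |: I' \in M &
      [/\ v \notin I', I' \subset X :\ v & #|I'| = j.+1].
    have [|J JM [vJ JI cJ]] := matroid_augment MM vM IM; first by rewrite cards1 (leq_ltn_trans _ jI).
    have [I0 I0J cI0] : exists2 I0 : {set V}, I0 \subset J :\ v & #|I0| = j.+1.
      have cJv : (j.+1 <= #|J :\ v|)%N.
        by move: jI; rewrite -cJ (cardsD1 v J) -sub1set vJ.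
      have [I0 /andP[I0J /eqP cI0]] : exists I0 : {set V}, (I0 \subset J :\ v) && (#|I0| == j.+1).
        have : (0 < #|[set A : {set V} | A \subset J :\ v & #|A| == j.+1]|)%N.
          by rewrite cards_draws bin_gt0.
        by rewrite card_gt0 => /set0Pn[A]; rewrite inE => ?; exists A.
      by exists I0.
    exists I0; last split=> //.
    - apply: Ms JM _; rewrite subUset vJ (subset_trans I0J) ?subsetDl //.
    - by apply/negP => /(subsetP I0J); rewrite !inE eqxx.
    - apply: subset_trans I0J _; rewrite subsetD1 !inE eqxx andbT subDset.
      by apply: subset_trans JI _; apply: setUS.
  apply: (IHn _ X'n _ I' j (contract_matroid MM vM)); rewrite ?I'j //.
  - by rewrite inE vI' I'M (Ms _ _ I'M) // subsetUr.
  - move=> s /hl[vs vsM vsX [sj]]; split=> //.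
    rewrite !inE vs vsM subsetD1 vs !andbT (Ms _ _ vsM) ?subsetUr //=.
    by apply: subset_trans vsX; apply: subsetUr.
  - exact: bd_link_part.
have [||b hb bdb] := IHn _ X'n _ _ j MM IM IX' jI (avoiding v c + a).
- apply: on_facesD.
    move=> s hs; have vs := avoiding_notin hs; move: hs; rewrite ffunE (negPf vs).
    by case/hc; rewrite !inE subsetD1 vs andbT.
  by move=> s /ha[]; rewrite !inE => /andP[/and3P[-> _ _] ->].
- by rewrite bdD bd_avoiding // bda addNr.
have av s : a s != 0 -> v \notin s by case/ha; rewrite !inE => /andP[/and3P[]].
exists (b - cone v a).
  apply: on_facesD.
    move=> s /hb[]; rewrite !inE subsetD1 => /andP[-> /andP[-> _]] -> //.
  apply: on_facesN => s; rewrite ffunE; case: ifP; rewrite ?eqxx // => vs.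
  case: (eqVneq (a (s :\ v)) 0) => [->|/ha[]]; first by rewrite mul0r eqxx.
  rewrite !inE setD1K // => /andP[/and3P[_ _ ->] sX] cs _.
  by rewrite (cardsD1 v s) vs cs -(setD1K vs) subUset sub1set vX (subset_trans sX) ?subsetDl.
by rewrite bdB bdb bd_cone // bda [RHS](cone_split v) opprB; apply/ffunP => s; rewrite !ffunE; ring.
Qed.

End Chains.

(** * Carried chain maps on cubes, built by induction on the dimension *)

Section Cubes.
Variable V : finType.
Implicit Types (s t A B S X : {set V}) (K M C : {set {set V}}) (L : {set V} -> {set {set V}}) (u v : V).
Implicit Types (c : {ffun {set V} -> rat}) (h g : {set V} -> {set V} -> {ffun {set V} -> rat}).

(* A pair A \subset B stands for the cube [A, B] of the face poset; its facets
   are the cubes [b |: A, B] and [A, B :\ b]. *)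
Definition cube_bd h A B : {ffun {set V} -> rat} := [ffun t : {set V} =>
  \sum_(b in B :\: A) sgn (B :\: A) b * (h (b |: A) B t - h A (B :\ b) t)].

Lemma cube_bdE h A B t : cube_bd h A B t =
  \sum_(b in B :\: A) sgn (B :\: A) b * (h (b |: A) B t - h A (B :\ b) t).
Proof. by rewrite ffunE. Qed.

Lemma facet_up A B b : B :\: (b |: A) = (B :\: A) :\ b.
Proof. by rewrite setDDl setUC. Qed.

Lemma facet_down A B b : (B :\ b) :\: A = (B :\: A) :\ b.
Proof. by rewrite !setDDl setUC. Qed.

Lemma cube_bdK h A B : cube_bd (cube_bd h) A B = 0.
Proof.
apply/ffunP => t; rewrite cube_bdE [RHS]ffunE; set S := B :\: A.
pose G u v := if [&& u \in S, v \in S & u != v] then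
  sgn S u * sgn (S :\ u) v *
  (h (v |: (u |: A)) B t - h (u |: A) (B :\ v) t - h (v |: A) (B :\ u) t + h A (B :\ u :\ v) t)
  else 0.
rewrite -[RHS](@sum_anti _ G) => [|u v]; last first.
  rewrite /G eq_sym andbCA; case: ifP; rewrite ?oppr0 // => /and3P[uS vS uv].
  rewrite (@sgn_anti _ S v u) // 1?eq_sym // (setU1CA u v) mulNr.
  have -> : B :\ v :\ u = B :\ u :\ v by rewrite !setDDl setUC.
  by rewrite opprK; congr (_ * _); ring.
rewrite big_mkcond; apply: eq_bigr => u _; rewrite /G.
case: ifP => uS; last by rewrite big1.
rewrite !cube_bdE facet_up facet_down -/S -sumrB mulr_sumr big_mkcond.
apply: eq_bigr => v _; rewrite !inE eq_sym andbC.
by case: ifP => // _; ring.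
Qed.

Lemma bd_cube_bd h A B :
  bd (cube_bd h A B) = cube_bd (fun A B => bd (h A B)) A B.
Proof.
apply/ffunP => t; rewrite bdE cube_bdE.
under eq_bigr => v vt do rewrite cube_bdE mulr_suml.
rewrite exchange_big; apply: eq_bigr => b bS /=.
by rewrite !bdE -sumrB mulr_sumr; apply: eq_bigr => v _; ring.
Qed.

Lemma on_faces_cube_bd K j h A B :
  (forall b, b \in B :\: A -> on_faces K j (h (b |: A) B) /\ on_faces K j (h A (B :\ b))) ->
  on_faces K j (cube_bd h A B).
Proof.
move=> hK t; rewrite cube_bdE => nz.
have [b bS] : exists2 b, b \in B :\: A & h (b |: A) B t - h A (B :\ b) t != 0.
  apply/exists_inP; apply: contraNT nz; rewrite negb_exists_in => /forall_inP z.
  by rewrite big1 // => b /z; rewrite negbK => /eqP->; rewrite mulr0.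
have [h1 h2] := hK b bS; case: (eqVneq (h (b |: A) B t) 0) => [->|/h1 //].
by rewrite sub0r oppr_eq0 => /h2.
Qed.

Lemma on_facesW K K' j c : K \subset K' -> on_faces K j c -> on_faces K' j c.
Proof. by move=> /subsetP KK hc s /hc[/KK]. Qed.

(** One equation for two uses, on cubes of dimension below [q] with carrier [L]. With [m = 0],
    [a = 1] and [g] the augmentation, [h] is a chain map; with [m = 1], [a = -1] and [g] a
    difference of chain maps, [h] is a homotopy between them. *)
Definition solves C L (m : nat) (a : rat) g (q : nat) h :=
  forall A B, A \subset B -> B \in C -> (#|B :\: A| < q)%N ->
    on_faces (L A) (#|B :\: A| + m).+1 (h A B) /\
    (forall t, bd (h A B) t = a * cube_bd h A B t + g A B t).

Lemma facet_card A B b q : b \in B :\: A -> #|B :\: A| = q ->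
  q = #|(B :\: A) :\ b|.+1.
Proof. by move=> bS <-; rewrite (cardsD1 b) bS. Qed.

(** Acyclic carriers: on a cube of dimension [q] the right-hand side is already known from the
    facets, it is a cycle in [L A], and acyclicity fills it. *)
Lemma solves_step C L m a g q h : is_complex C ->
  (forall A B, A \subset B -> L B \subset L A) ->
  (forall A, A \in C -> acyclic (L A) (q + m)) ->
  (forall A B, A \subset B -> B \in C -> #|B :\: A| = q ->
     on_faces (L A) (q + m) (g A B) /\ forall t, bd (g A B) t = - a * cube_bd g A B t) ->
  solves C L m a g q h -> exists h', solves C L m a g q.+1 h'.
Proof.
move=> Cc Kanti acK hg hh.
pose rhs A B := [ffun t => a * cube_bd h A B t + g A B t].
(* The conditions on the cube stand under the existential, with 0 as default, so that fillings can
   be chosen for all pairs at once. *)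
have fill A B : exists b, A \subset B -> B \in C -> #|B :\: A| = q ->
    on_faces (L A) (q + m).+1 b /\ bd b = rhs A B.
  case: (boolP [&& A \subset B, B \in C & #|B :\: A| == q]); last first.
    by move=> no; exists 0 => AB BC cq; case/negP: no; rewrite AB BC cq /=.
  case/and3P => AB BC /eqP cq; have AC := Cc _ _ BC AB.
  have [gK gbd] := hg _ _ AB BC cq.
  have facets b : b \in B :\: A ->
      [/\ on_faces (L A) (q + m) (h (b |: A) B),
          on_faces (L A) (q + m) (h A (B :\ b)),
          forall t, bd (h (b |: A) B) t = a * cube_bd h (b |: A) B t + g (b |: A) B t &
          forall t, bd (h A (B :\ b)) t = a * cube_bd h A (B :\ b) t + g A (B :\ b) t].
    move=> bS; have cb := facet_card bS cq; have /setDP[bB bA] := bS.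
    have [||h1 e1] := hh (b |: A) B _ BC.
    - by rewrite subUset sub1set bB.
    - by rewrite facet_up [X in (_ < X)%N]cb.
    have [|||h2 e2] := hh A (B :\ b).
    - by rewrite subsetD1 AB.
    - by apply: Cc BC _; apply: subsetDl.
    - by rewrite facet_down [X in (_ < X)%N]cb.
    split=> //; last by rewrite cb addSn -facet_down.
    by apply: on_facesW (Kanti _ _ (subsetUr [set b] A)) _; rewrite cb addSn -facet_up.
  have [||b bK bbd] := acK _ AC (rhs A B).
  - move=> t; rewrite ffunE; case: (eqVneq (g A B t) 0) => [->|/gK //].
    rewrite addr0 mulf_eq0 negb_or => /andP[_]; move: t.
    by apply: on_faces_cube_bd => b /facets[].
  (* After substitution of the facet equations, a double cube boundary vanishes and the two terms in
     [g] cancel. *)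
  - apply/ffunP => t; rewrite bd_lin gbd bd_cube_bd [RHS]ffunE.
    suff -> : cube_bd (fun A B => bd (h A B)) A B t = a * cube_bd (cube_bd h) A B t + cube_bd g A B t.
      by rewrite cube_bdK ffunE; ring.
    rewrite !cube_bdE mulr_sumr -big_split; apply: eq_bigr => b /facets[_ _ -> ->] /=.
    ring.
  by exists b.
have [F hF] := fin_all_exists (fun p : {set V} * {set V} => fill p.1 p.2).
exists (fun A B => if #|B :\: A| == q then F (A, B) else h A B).
have low A B : (#|B :\: A| <= q)%N ->
    cube_bd (fun A B => if #|B :\: A| == q then F (A, B) else h A B) A B = cube_bd h A B.
  move=> le; apply/ffunP => t; rewrite !cube_bdE; apply: eq_bigr => b bS.
  have lt : (#|(B :\: A) :\ b| < q)%N by apply: leq_trans le; rewrite [X in (_ < X)%N](cardsD1 b) bS.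
  by rewrite facet_up facet_down ltn_eqF.
move=> A B AB BC; rewrite ltnS => le; rewrite low //.
case: eqP => [cq|/eqP nq].
  have [FK Fbd] := hF (A, B) AB BC cq; rewrite cq; split=> // t.
  by rewrite Fbd ffunE.
by apply: hh => //; rewrite ltn_neqAle nq.
Qed.

(** For [q = 0] the hypothesis on [h] is vacuous, so solutions can also be built from nothing. *)
Lemma solves_extend C L m a g q h n : is_complex C ->
  (forall A B, A \subset B -> L B \subset L A) ->
  (forall A p, A \in C -> (q <= p < q + n)%N -> acyclic (L A) (p + m)) ->
  (forall A B, A \subset B -> B \in C -> (#|B :\: A| < q + n)%N ->
     on_faces (L A) (#|B :\: A| + m) (g A B) /\ forall t, bd (g A B) t = - a * cube_bd g A B t) ->
  solves C L m a g q h -> exists h', solves C L m a g (q + n) h'.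
Proof.
move=> Cc Kanti acK hg hh; elim: n acK hg => [|n IHn] acK hg; first by exists h; rewrite addn0.
have [||h' hh'] := IHn.
- by move=> A p AC /andP[qp pn]; apply: acK => //; rewrite qp addnS ltnS ltnW.
- by move=> A B AB BC lt; apply: hg => //; rewrite addnS ltnS ltnW.
rewrite addnS; apply: solves_step hh' => //.
  by move=> A AC; apply: acK => //; rewrite leq_addr addnS ltnS leqnn.
by move=> A B AB BC cq; rewrite -cq; apply: hg => //; rewrite cq addnS.
Qed.

(** * The augmentation and the Lefschetz trace argument *)

Definition unit0 : {ffun {set V} -> rat} := [ffun t : {set V} => (t == set0)%:R].
(** As the term [g] of [solves], it makes the image of each vertex [[A, A]] have the empty face as
    boundary, so that augmentation is preserved. *)
Definition augm A B : {ffun {set V} -> rat} := if A == B then unit0 else 0.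

Lemma bd_augm A B : bd (augm A B) = 0.
Proof.
rewrite /augm; case: ifP => _; last exact: bd0.
apply/ffunP => t; rewrite bdE [RHS]ffunE big1 // => v vt.
have -> : unit0 (v |: t) = 0; last by rewrite mul0r.
by rewrite ffunE; case: eqP => // /setP/(_ v); rewrite !inE eqxx.
Qed.

(** The two ends of an edge contribute the empty face with opposite signs. *)
Lemma cube_bd_augm A B : A \subset B -> cube_bd augm A B = 0.
Proof.
move=> AB; apply/ffunP => t; rewrite cube_bdE [RHS]ffunE big1 // => b /setDP[bB bA].
rewrite /augm; suff -> : (b |: A == B) = (A == B :\ b) by rewrite subrr mulr0.
apply/eqP/eqP => [<-|->]; first by rewrite setU1K.
by rewrite setD1K.
Qed.

Lemma on_faces_augm K A B : set0 \in K -> on_faces K #|B :\: A| (augm A B).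
Proof.
move=> K0 t; rewrite /augm; case: (A =P B) => [->|_]; rewrite ffunE ?eqxx // setDv cards0.
by case: (eqVneq t set0) => [->|]; rewrite ?cards0 ?eqxx.
Qed.

Lemma sum_coface (G : {set V} -> V -> rat) :
  \sum_(B : {set V}) \sum_(v | v \notin B) G (v |: B) v = \sum_(S : {set V}) \sum_(v in S) G S v.
Proof.
under eq_bigr do rewrite big_mkcond; rewrite exchange_big /=.
under [RHS]eq_bigr do rewrite big_mkcond; rewrite [RHS]exchange_big /=.
apply: eq_bigr => v _; rewrite -!big_mkcond /=.
rewrite [RHS](reindex_onto (fun B => v |: B) (fun S => S :\ v)) /= => [|S vS]; last by rewrite setD1K.
apply: eq_bigl => B; rewrite setU11 /=.
by apply/idP/eqP => [/setU1K //|<-]; rewrite !inE eqxx.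
Qed.

(* Lefschetz: with k B := h set0 B, the map bd k + k bd is the identity on the
   empty face and has zero diagonal elsewhere, since h [set b] B avoids b.
   Its supertrace is therefore 1, but that of a commutator vanishes. *)
Lemma no_avoiding_map C h n : is_complex C -> set0 \in C -> (#|V| < n)%N ->
  ~ solves C (fun A => induced C (~: A)) 0 1 augm n h.
Proof.
move=> Cc C0 nV hh.
pose k B := h set0 B.
have big B A : (#|B :\: A| < n)%N.
  by apply: leq_ltn_trans nV; rewrite -cardsT subset_leq_card // subsetT.
have kC B S : B \in C -> k B S != 0 -> S \in C.
  move=> BC; have [|hK _] := hh set0 B (sub0set _) BC; first exact: big.
  by case/hK; rewrite inE => /andP[].
(* The contribution of the pair [S :\ v], [S]: it enters the supertrace once from each of the two
   faces, with opposite signs. *)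
pose phi S v := if S \in C then (-1) ^+ #|S| * (k (S :\ v) S * sgn S v) else 0.
have diag B : B \in C -> (B == set0)%:R =
    (-1) ^+ #|B| * (\sum_(v | v \notin B) k B (v |: B) * sgn (v |: B) v
       + \sum_(v in B) k (B :\ v) B * sgn B v) :> rat.
  (* The equation of the cube [[set0, B]] is read at the face [B] itself. *)
  move=> BC; have [|_ /(_ B)] := hh set0 B (sub0set _) BC; first exact: big.
  rewrite bdE cube_bdE setD0 mul1r => e.
  have aug : augm set0 B B = (B == set0)%:R.
    by rewrite /augm eq_sym; case: eqP => [->|_]; rewrite ffunE ?eqxx.
  have -> : (B == set0)%:R = (-1) ^+ #|B| * augm set0 B B.
    by rewrite aug; case: eqP => [->|_]; rewrite ?mulr0 // cards0 mul1r.
  congr (_ * _); rewrite e addrAC -big_split big1 ?add0r //= => b bB.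
  have [||hb _] := hh (b |: set0) B _ BC; [by rewrite setU0 sub1set | exact: big | ].
  rewrite setU0 in hb *.
  have -> : h [set b] B B = 0.
    apply/eqP; apply/negPn/negP => /hb[]; rewrite inE => /andP[_ /subsetP/(_ _ bB)].
    by rewrite !inE eqxx.
  by rewrite /k; ring.
have : \sum_(B in C) (B == set0)%:R = 0 :> rat.
  transitivity (\sum_(B : {set V}) \sum_(v | v \notin B) (- phi (v |: B) v) + \sum_(B : {set V}) \sum_(v in B) phi B v).
    rewrite big_mkcond -big_split /=; apply: eq_bigr => B _; case: ifP => BC; last first.
      rewrite !big1 ?addr0 // => v vB; rewrite /phi ?BC //.
      by case: ifP => [/Cc/(_ (subsetUr _ _))|]; rewrite ?BC ?oppr0.
    rewrite diag // mulrDr !mulr_sumr; congr (_ + _); apply: eq_bigr => v vB; last first.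
      by rewrite /phi BC.
    rewrite /phi setU1K // cardsU1 vB exprS; case: ifP => [_|nC]; first by ring.
    have -> : k B (v |: B) = 0 by apply/eqP; apply: contraFT nC; apply: kC.
    by rewrite !mul0r mulr0 oppr0.
  by rewrite (sum_coface (fun S v => - phi S v)) -big_split big1 //= => S _;
    rewrite sumrN addNr.
rewrite (bigD1 set0) //= eqxx big1 => [|B /andP[_ /negPf->] //].
by move/eqP; rewrite addr0 oner_eq0.
Qed.

End Cubes.

(** * Independent nonfaces cannot be separated *)

Section Separation.
Variable V : finType.
Implicit Types (s t A B I J X : {set V}) (C M : {set {set V}}).

Lemma mrank_ge M X I : I \in M -> I \subset X -> (#|I| <= mrank M X)%N.
Proof. by move=> IM IX; apply: (@leq_bigmax_cond _ _ _ I); rewrite IM. Qed.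

Lemma mrank_attained M X : set0 \in M ->
  exists I, [/\ I \in M, I \subset X & #|I| = mrank M X].
Proof.
move=> M0; have [|I IP mI] := @eq_bigmax_cond _ [pred I : {set V} | (I \in M) && (I \subset X)] (fun I : {set V} => #|I|).
  by apply/card_gt0P; exists set0; rewrite inE M0 sub0set.
by case/andP: IP => IM IX; exists I; split; rewrite // /mrank mI.
Qed.

(** As [B0] is a nonface, [B0 :\: A] is nonempty for every face [A], and its full simplex is a
    cone. *)
Lemma simplex_map C B0 n : is_complex C -> B0 \notin C ->
  exists f, solves C (fun A => powerset (B0 :\: A)) 0 1 (@augm V) n f.
Proof.
move=> Cc B0C; rewrite -(add0n n).
apply: (@solves_extend V C _ 0 1 (@augm V) 0 (fun _ _ => 0)) => //.
- by move=> A B AB; rewrite powersetS; apply: setDS.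
- move=> A p AC _; have [v vBA] : exists v, v \in B0 :\: A.
    apply/set0Pn; rewrite setD_eq0; apply: contra B0C; exact: Cc AC.
  apply: (@acyclic_cone _ _ v) => s; rewrite !inE => sBA.
  by rewrite subUset sub1set vBA.
- move=> A B AB BC _; rewrite addn0; split.
    by apply: on_faces_augm; rewrite inE sub0set.
  by move=> t; rewrite bd_augm cube_bd_augm // ffunE mulr0.
Qed.

(** Here [q] is the indicator of one of the two families; its invariance under inclusion allows the
    homotopy to be cut along it. *)
Lemma nonfaces_connected C M d (q : pred {set V}) B1 B2 :
  is_complex C -> is_matroid M -> leray C d ->
  (forall A, A \in C -> (d + 2 <= mrank M (~: A))%N) -> set0 \in C ->
  (forall s t, t \subset s -> s \in M -> t \notin C -> q t = q s) ->
  B1 \in M -> B2 \in M -> B1 \notin C -> B2 \notin C -> q B1 -> q B2.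
Proof.
move=> Cc MM Cl rk C0 qP B1M B2M B1C B2C qB1; apply/negPn/negP => qB2.
have [M0 Ms Mx] := MM.
have [f1 hf1] := simplex_map d.+1 Cc B1C.
have [f2 hf2] := simplex_map d.+1 Cc B2C.
have indM (B0 A : {set V}) : B0 \in M -> powerset (B0 :\: A) \subset induced M (~: A).
  move=> B0M; apply/subsetP => s; rewrite !inE subsetD disjoints_subset => /andP[sB0 ->].
  by rewrite andbT; apply: Ms B0M sB0.
have indA (K : {set {set V}}) A B : A \subset B -> induced K (~: B) \subset induced K (~: A).
  move=> AB; apply/subsetP => s; rewrite !inE => /andP[-> sB] /=.
  by apply: subset_trans sB _; rewrite setCS.
pose g A B := f1 A B - f2 A B.
(* The equation reads [bd x + cube_bd x = f1 - f2]. *)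
have [x hx] : exists x, solves C (fun A => induced M (~: A)) 1 (-1) g (0 + d.+1) x.
  apply: (@solves_extend V C _ 1 (-1) g 0 (fun _ _ => 0)) => //.
  - by move=> A B; apply: indA.
  (* A cube of dimension [p <= d] needs acyclicity in degree [p + 1], which is below the rank
     [d + 2]. *)
  - move=> A p AC /andP[_ pd].
    have [I [IM IA cI]] := mrank_attained (~: A) M0.
    apply: (matroid_acyclic MM IM IA); rewrite cI; apply: leq_trans (rk _ AC).
    by rewrite addn1 addn2.
  - move=> A B AB BC lt; have [f1K e1] := hf1 A B AB BC lt; have [f2K e2] := hf2 A B AB BC lt.
    rewrite addn0 in f1K f2K; rewrite addn1; split.
      apply: on_facesD; first exact: on_facesW (indM _ _ B1M) f1K.
      by apply: on_facesN; apply: on_facesW (indM _ _ B2M) f2K.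
    move=> t; rewrite /g bdB addcE oppcE e1 e2 opprK !mul1r !cube_bdE.
    rewrite opprD addrACA subrr addr0 -sumrB.
    by apply: eq_bigr => b _; rewrite !addcE !oppcE; ring.
pose part (c : {ffun {set V} -> rat}) : {ffun {set V} -> rat} :=
  [ffun t : {set V} => if (t \notin C) && q t then c t else 0].
pose x1 A B := part (x A B).
have partK K j c : on_faces K j c -> on_faces K j (part c).
  by move=> cK t; rewrite ffunE; case: ifP => [_ /cK|_] //; rewrite eqxx.
(* This stays a chain map for any choice of [x1], since [bd] and [cube_bd] commute and square to
   zero. *)
pose f A B := f1 A B - bd (x1 A B) - cube_bd x1 A B.
have hf : solves C (fun A => induced C (~: A)) 0 1 (@augm V) d.+1 f.
  move=> A B AB BC lt.
  have [f1K e1] := hf1 A B AB BC lt; have [f2K e2] := hf2 A B AB BC lt.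
  have [xK ex] := hx A B AB BC lt; rewrite addn1 in xK; rewrite addn0 in f1K f2K *.
  split; last first.
    move=> t; rewrite /f !bdB bdK subr0 bd_cube_bd mul1r addcE oppcE e1 mul1r.
    have -> : cube_bd f A B t = cube_bd f1 A B t
        - cube_bd (fun A B => bd (x1 A B)) A B t - cube_bd (cube_bd x1) A B t.
      rewrite !cube_bdE -!sumrB; apply: eq_bigr => b _.
      by rewrite /f !addcE !oppcE; ring.
    have z : (0 : {ffun {set V} -> rat}) t = 0 by rewrite ffunE.
    by rewrite cube_bdK z subr0 addrAC.
  have fM : on_faces (induced M (~: A)) #|B :\: A|.+1 (f A B).
    apply: on_facesD; last apply: on_facesN.
      apply: on_facesD; first exact: on_facesW (indM _ _ B1M) f1K.
      by apply/on_facesN/on_faces_bd; [exact: induced_complex | exact: partK].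
    apply: on_faces_cube_bd => b bS; have cb := facet_card bS erefl.
    have /setDP[bB bA] := bS.
    have [||h1 _] := hx (b |: A) B _ BC.
    - by rewrite subUset sub1set bB.
    - by rewrite facet_up; apply: leq_trans lt; rewrite cb ltnS leqnSn.
    have [|||h2 _] := hx A (B :\ b).
    - by rewrite subsetD1 AB.
    - by apply: Cc BC _; apply: subsetDl.
    - by rewrite facet_down; apply: leq_trans lt; rewrite cb ltnS leqnSn.
    rewrite facet_up addn1 -cb in h1; rewrite facet_down addn1 -cb in h2.
    split; apply: partK => //.
    by apply: on_facesW h1; apply/indA/subsetUr.
  move=> t ft; have [tM ct] := fM t ft; split=> //; move: tM; rewrite !inE => /andP[tM ->].
  rewrite andbT; apply/negPn/negP => tC.
  have sub0 (B0 : {set V}) : B0 \in M -> t \subset B0 :\: A -> q t = q B0.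
    by move=> B0M; rewrite subsetD => /andP[tB0 _]; apply: qP.
  (* If [q t], then [q] holds on all cofaces of [t] in [x], so [x1] acts at [t] as [x] does and the
     coefficient is that of [f2]. If nonzero, it puts [t] inside [B2], where [q] fails. *)
  move: ft; rewrite /f !addcE !oppcE; case qt: (q t).
    have -> : bd (x1 A B) t = bd (x A B) t.
      rewrite !bdE; apply: eq_bigr => v _; congr (_ * _); rewrite ffunE.
      case: (eqVneq (x A B (v |: t)) 0) => [->|/xK[]]; first by case: ifP.
      rewrite inE => /andP[vtM _] _; rewrite -(qP _ _ (subsetUr [set v] t)) // qt andbT.
      by rewrite (contraNN _ tC) // => /Cc; apply; apply: subsetUr.
    have -> : cube_bd x1 A B t = cube_bd x A B t.
      by rewrite !cube_bdE; apply: eq_bigr => b _; rewrite !ffunE tC qt.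
    rewrite ex /g addcE oppcE mulN1r => nz.
    have /f2K[] : f2 A B t != 0 by apply: contraNneq nz => ->; apply/eqP; ring.
    by rewrite inE => /(sub0 _ B2M) e; move: qB2; rewrite -e qt.
  (* If [q t] fails, [x1] contributes nothing at [t] and the coefficient is that of [f1]. If
     nonzero, it puts [t] inside [B1], where [q] holds. *)
  have -> : bd (x1 A B) t = 0.
    rewrite !bdE big1 // => v _; rewrite ffunE.
    case: ifP; rewrite ?mul0r // => /andP[_ qv].
    case: (eqVneq (x A B (v |: t)) 0) => [->|/xK[]]; first by rewrite mul0r.
    by rewrite inE => /andP[vtM _] _; rewrite -(qP _ _ (subsetUr [set v] t)) // qt in qv.
  have -> : cube_bd x1 A B t = 0.
    by rewrite cube_bdE big1 // => b _; rewrite !ffunE qt andbF subrr mulr0.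
  rewrite !subr0 => /f1K[]; rewrite inE => /(sub0 _ B1M) e.
  by rewrite e qB1 in qt.
(* A cube of dimension [p > d] needs homology to vanish in dimension [p - 1 >= d], which is the
   Leray property. The [#|V|] further steps reach every cube. *)
have [|||k hk] := @solves_extend V C _ 0 1 (@augm V) d.+1 f #|V| Cc _ _ _ hf.
- by move=> A B; apply: indA.
- move=> A [//|p] AC /andP[dp _]; rewrite addn0 => c cK c0.
  have [|b [bK bb]] := Cl (~: A) p dp c cK.
    by move=> t; have /ffunP/(_ t) := c0; rewrite !ffunE.
  by exists b => //; apply/ffunP => t; rewrite ffunE bb.
- move=> A B AB BC _; rewrite addn0; split.
    by apply: on_faces_augm; rewrite inE C0 sub0set.
  by move=> t; rewrite bd_augm cube_bd_augm // ffunE mulr0.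
by apply: no_avoiding_map hk => //; rewrite addSn ltnS leq_addl.
Qed.

(** * Bases of the dual matroid and paths of exchanges *)

Lemma mrank_leT M X : (mrank M X <= mrankT M)%N.
Proof.
by apply/bigmax_leqP => I /andP[IM _]; apply: mrank_ge; rewrite ?subsetT.
Qed.

Lemma mrankT_dual M : set0 \in M -> mrankT (dual_matroid M) = (#|V| - mrankT M)%N.
Proof.
move=> M0; apply/eqP; rewrite eqn_leq; apply/andP; split.
  apply/bigmax_leqP => A /andP[]; rewrite inE => /eqP rA _.
  have [I [_ IA cI]] := mrank_attained (~: A) M0.
  by rewrite -rA -cI -[#|A|](addnK #|~: A|) cardsC leq_sub2l // subset_leq_card.
have [B [BM _ cB]] := mrank_attained setT M0.
rewrite -[mrankT M]cB -(cardsC B) addKn; apply: mrank_ge; rewrite ?subsetT //.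
by rewrite inE setCK eqn_leq mrank_leT /= -[mrankT M]cB mrank_ge.
Qed.

Lemma is_basis_dual M A : set0 \in M -> is_basis (dual_matroid M) A = is_basis M (~: A).
Proof.
move=> M0; rewrite /is_basis mrankT_dual // inE -(cardsC A).
have rle : (mrankT M <= #|V|)%N by apply/bigmax_leqP => I _; apply: max_card.
apply/andP/andP => [[/eqP rA cA]|[AM /eqP cA]].
  have [I [IM IA cI]] := mrank_attained (~: A) M0.
  have cAr : #|~: A| = mrankT M.
    move: rle cA; rewrite -(cardsC A) => rle /eqP cA.
    by apply/(@addnI #|A|); rewrite {2}cA subnK.
  have /eqP IE : I == ~: A by rewrite eqEcard IA cAr cI rA leqnn.
  by rewrite cAr eqxx -IE.
rewrite cA addnK eqxx; split=> //.
by rewrite eqn_leq mrank_leT -cA mrank_ge.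
Qed.

Lemma RG_vertexE C M A : set0 \in M ->
  RG_vertex (alexander_dual C) (dual_matroid M) A = is_basis M (~: A) && (~: A \notin C).
Proof. by move=> M0; rewrite /RG_vertex is_basis_dual // inE. Qed.

(** Exchanging an element of [B] outside [B'] for one of [B'] brings [B] closer to [B'] and leaves
    [X] in place. All bases on the way, and the intersections of consecutive ones, contain the
    nonface [X], so they are nonfaces. *)
Lemma basis_exchange_connect C M B B' X : is_matroid M ->
  is_complex C -> X \notin C -> X \subset B -> X \subset B' ->
  is_basis M B -> is_basis M B' ->
  connect (RG_adj (alexander_dual C) (dual_matroid M)) (~: B) (~: B').
Proof.
case=> M0 Ms Mx Cc XC XB XB' + bB'; have /andP[B'M /eqP cB'] := bB'.
have up A : X \subset A -> A \notin C by move=> XA; apply: contraNN XC => /Cc; apply.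
elim: {B}_.+1 {-2}B (ltnSn #|B :\: B'|) XB => // n IHn B Bn XB bB.
have /andP[BM /eqP cB] := bB.
have [/eqP|/set0Pn[x xBB']] := boolP (B :\: B' == set0).
  move/eqP; rewrite setD_eq0 => BB'.
  by have /eqP -> : B == B' by rewrite eqEcard BB' cB cB' leqnn.
have /setDP[xB xB'] := xBB'.
have cBx : #|B| = #|B :\ x|.+1 by rewrite (cardsD1 x B) xB.
have [||y] := Mx (B :\ x) B' _ B'M; first by apply: Ms BM _; apply: subsetDl.
  by rewrite cB' -cB cBx.
rewrite !inE negb_and negbK => /andP[/orP[/eqP->|yB] yB']; first by rewrite yB' in xB'.
move=> yM; set B2 := y |: (B :\ x) in yM.
have yBx : y \notin B :\ x by rewrite !inE negb_and yB orbT.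
have bB2 : is_basis M B2 by rewrite /is_basis yM cardsU1 yBx add1n -cBx cB eqxx.
have XBx : X \subset B :\ x.
  by rewrite subsetD1 XB; apply: contra xB'; apply: (subsetP XB').
have XB2 : X \subset B2 by apply: subset_trans XBx (subsetUr _ _).
apply: connect_trans (IHn B2 _ XB2 bB2).
  apply: connect1; have meet : B :&: B2 = B :\ x.
    apply/setP => z; rewrite !inE; case: (eqVneq z y) => [->|_].
      by rewrite (negPf yB) andbF.
    by rewrite /=; case: (z \in B); rewrite ?andbF ?andbT.
  (* The union of the two complements is the complement of [B :\ x], one element more than the dual
     rank. *)
  rewrite /RG_adj !RG_vertexE // !setCK bB bB2 !up //= -setCI meet inE setCK up //=.
  rewrite mrankT_dual // -cB cBx -(cardsC (B :\ x)).
  have : (0 < #|~: (B :\ x)|)%N by apply/card_gt0P; exists y; rewrite inE.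
  by case: #|~: _| => // k _; rewrite addnS subSS addKn.
rewrite ltnS in Bn; apply: leq_trans _ Bn.
have -> : B2 :\: B' = (B :\: B') :\ x.
  apply/setP => z; rewrite !inE; case: (eqVneq z y) => [->|_] /=; first by rewrite yB' andbF.
  by rewrite andbCA.
by rewrite [X in (_ < X)%N](cardsD1 x) xBB'.
Qed.

Lemma basis_extends M I : is_matroid M -> I \in M ->
  exists2 B : {set V}, I \subset B & is_basis M B.
Proof.
move=> MM IM; have [M0 Ms Mx] := MM; have [J [JM _ cJ]] := mrank_attained setT M0.
have [|B BM [IB _ cB]] := matroid_augment MM IM JM.
  by rewrite cJ mrank_ge ?subsetT.
by exists B => //; rewrite /is_basis BM cB cJ eqxx.
Qed.

End Separation.

(** * Connectedness of the graph *)

Theorem theorem7p7 (V : finType) (C M : {set {set V}}) (d : nat) :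
  is_complex C -> is_matroid M ->
  leray C d ->
  (forall A, A \in C -> (d + 2 <= mrank M (~: A))%N) ->
  RG_connected (alexander_dual C) (dual_matroid M).
Proof.
move=> Cc MM Cl rk S1 S2; have [M0 Ms _] := MM; rewrite !RG_vertexE // => /andP[b1 n1] /andP[b2 n2].
rewrite -[S1]setCK -[S2]setCK; move: (~: S1) (~: S2) b1 n1 b2 n2 => B1 B2 b1 n1 b2 n2.
(* If the empty set is a nonface, it serves as the common nonface of any two bases. *)
have [C0|C0] := boolP (set0 \in C); last first.
  by apply: basis_exchange_connect C0 _ _ b1 b2; rewrite ?sub0set.
(* The family attached to the component of [B1]: the sets inside some basis of that component. *)
pose q (s : {set V}) := [exists B : {set V}, [&& is_basis M B, s \subset B &
  connect (RG_adj (alexander_dual C) (dual_matroid M)) (~: B1) (~: B)]].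
have bM B : is_basis M B -> B \in M by case/andP.
have qB1 : q B1 by apply/existsP; exists B1; rewrite b1 subxx connect0.
suff : q B2.
  case/existsP => B /and3P[bB B2B conn]; apply: connect_trans conn _.
  exact: basis_exchange_connect n2 _ _ bB b2.
apply: (nonfaces_connected Cc MM Cl rk C0 _ (bM _ b1) (bM _ b2) n1 n2 qB1).
move=> s t ts sM tC; apply/existsP/existsP => -[B /and3P[bB sB conn]]; last first.
  by exists B; rewrite bB conn (subset_trans ts).
(* The basis [B] over [t] need not contain [s], but it shares the nonface [t] with any basis [B']
   over [s], so exchanges join the two. *)
have [B' sB' bB'] := basis_extends MM sM; exists B'; rewrite bB' sB'.
apply: connect_trans conn _; apply: basis_exchange_connect tC _ _ bB bB' => //.
exact: subset_trans ts _.
Qed.
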